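(* Let $\widetilde A\in\mathbb{R}^{m\times n}$, $\widetilde A\neq 0$, $\widetilde b\in\mathbb{R}^m$, let $x_0\in\mathbb{R}^n$ be arbitrary, and let $\{x_k\}$ be the iterates of the randomized Kaczmarz algorithm applied to $\widetilde A x\approx\widetilde b$ and started at $x_0$. For $1\le j\le \mathrm{rank}(\widetilde A)$ let $\widetilde u_j$ and $\widetilde v_j$ be the $j$-th left and right singular vectors of $\widetilde A$ associated with the singular value $\widetilde\sigma_j>0$. Then, for any $x_*\in\mathbb{R}^n$, every such $j$ and every $k\ge 0$, $$\mathbb{E}\,\langle x_{k} - x_0^n-x_*^r,\widetilde v_j \rangle = \left(1-\frac{\widetilde{\sigma}_j^2}{\|\widetilde{A}\|_F^2}\right)^{k}\langle x_0^r-x_*^r,\widetilde v_j \rangle - \left[1- \left(1-\frac{\widetilde{\sigma}_j^2}{\|\widetilde A\|_F^2}\right)^k\right]\frac{\langle \widetilde{A} x_* - \widetilde{b}, \widetilde u_j \rangle}{\widetilde{\sigma}_{j}}.$$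
   Context: Randomized Kaczmarz (RK) algorithm applied to $\widetilde A x\approx \widetilde b$ (a possibly inconsistent system): let $\widetilde a_i^\top$ denote the $i$-th row of $\widetilde A$. Starting from a deterministic $x_0\in\mathbb{R}^n$, for $k=0,1,2,\dots$, $$x_{k+1}=x_k-\frac{\widetilde a_{i(k)}^\top x_k-\widetilde b_{i(k)}}{\|\widetilde a_{i(k)}\|^2}\,\widetilde a_{i(k)},$$ where the indices $i(k)$ are drawn independently from $\{1,\dots,m\}$ with $\mathrm{Prob}(i(k)=i)=\|\widetilde a_i\|^2/\|\widetilde A\|_F^2$ (so zero rows are never selected). The expectation is over the random choice of indices. Here $\|\cdot\|_F$ is the Frobenius norm and $\langle\cdot,\cdot\rangle$ the Euclidean inner product. For $v\in\mathbb{R}^n$, $v^r$ denotes the orthogonal projection of $v$ onto $\mathrm{range}(\widetilde A^\top)$ and $v^n$ the orthogonal projection of $v$ onto $\mathrm{null}(\widetilde A)$. The singular vectors come from a fixed singular value decomposition of $\widetilde A$, so $\widetilde A\widetilde v_j=\widetilde\sigma_j\widetilde u_j$ and $\widetilde A^\top\widetilde u_j=\widetilde\sigma_j\widetilde v_j$, with $\{\widetilde u_j\}$ and $\{\widetilde v_j\}$ orthonormal. *)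

(* Defs.v *)
(* Library world: MathComp with MathComp-Analysis. *)
From HB Require Import structures.
From mathcomp Require Import all_boot all_order all_algebra.
From mathcomp Require Import all_classical all_reals all_analysis.

Set Implicit Arguments.
Unset Strict Implicit.
Unset Printing Implicit Defensive.

Import Order.TTheory GRing.Theory Num.Theory.
Local Open Scope classical_set_scope.
Local Open Scope ring_scope.

Section Euclidean.
Context {R : realType}.

Definition dot n (u v : 'cV[R]_n) : R := \sum_i u i 0 * v i 0.

(* MathComp-Analysis norms matrices by the maximum of the entries, hence the
   explicit Euclidean and Frobenius norms. *)
Definition norm2 n (v : 'cV[R]_n) : R := Num.sqrt (dot v v).

Definition normF m n (A : 'M[R]_(m, n)) : R :=
  Num.sqrt (\sum_i \sum_j A i j ^+ 2).

(* Orthogonal projection onto the span of the rows of W: the projection onto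
   that span along its orthogonal complement, which is the row space of
   [kermx W^T].  The transpositions are there because MathComp represents
   subspaces as row spaces. *)
Definition orthproj p n (W : 'M[R]_(p, n)) (v : 'cV[R]_n) : 'cV[R]_n :=
  (v^T *m proj_mx <<W>>%MS (kermx W^T))^T.

(* range(A^T) is the row space of A. *)
Definition range_part m n (A : 'M[R]_(m, n)) (v : 'cV[R]_n) : 'cV[R]_n :=
  orthproj A v.

(* The rows of [kermx A^T] span {w | w A^T = 0}, i.e. null(A). *)
Definition null_part m n (A : 'M[R]_(m, n)) (v : 'cV[R]_n) : 'cV[R]_n :=
  orthproj (kermx A^T) v.

Lemma dotE n (u v : 'cV[R]_n) : dot u v = (u^T *m v) 0 0.
Proof. by rewrite mxE; apply: eq_bigr => i _; rewrite mxE. Qed.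

Lemma dot_eq0 n (v : 'cV[R]_n) : dot v v = 0 -> v = 0.
Proof.
move/eqP; rewrite psumr_eq0 => [|i _]; last by rewrite -expr2 sqr_ge0.
move=> /allP v0; apply/colP => i; rewrite mxE.
by have /eqP := v0 i (mem_index_enum _); rewrite /= -expr2 => /eqP;
   rewrite sqrf_eq0 => /eqP.
Qed.

Lemma cap_orth p n (W : 'M[R]_(p, n)) : (<<W>> :&: kermx W^T)%MS = 0.
Proof.
apply/eqP; rewrite -submx0; apply/rV_subP => w.
rewrite sub_capmx genmxE => /andP[/submxP[D ->] /sub_kermxP DW0].
have /dot_eq0 : dot (D *m W)^T (D *m W)^T = 0.
  by rewrite dotE trmxK trmx_mul mulmxA DW0 mul0mx mxE.
by move/(congr1 trmx); rewrite trmxK trmx0 => ->; apply: sub0mx.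
Qed.

Lemma add_orth p n (W : 'M[R]_(p, n)) : (1%:M <= <<W>> + kermx W^T)%MS.
Proof.
rewrite sub1mx /row_full; apply/eqP.
have := mxrank_sum_cap <<W>>%MS (kermx W^T).
rewrite cap_orth mxrank0 addn0 => ->.
by rewrite genmxE mxrank_ker mxrank_tr subnKC // rank_leq_col.
Qed.

(* The defining property of the orthogonal projection. *)
Lemma orthprojP p n (W : 'M[R]_(p, n)) (v : 'cV[R]_n) :
  ((orthproj W v)^T <= W)%MS /\
  forall w : 'cV[R]_n, (w^T <= W)%MS -> dot w (v - orthproj W v) = 0.
Proof.
split; first by rewrite trmxK -[X in (_ <= X)%MS]/W -(genmxE W) proj_mx_sub.
move=> w /submxP[D wE].
have /sub_kermxP vW0 : (v^T - v^T *m proj_mx <<W>> (kermx W^T) <= kermx W^T)%MS.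
  by apply: proj_mx_compl_sub; apply: submx_trans (submx1 _) (add_orth W).
rewrite dotE wE -mulmxA.
have -> : W *m (v - orthproj W v) = 0.
  apply: trmx_inj; rewrite trmx_mul linearB /= /orthproj trmxK trmx0.
  exact: vW0.
by rewrite mulmx0 mxE.
Qed.

(* Full singular value decomposition A = U S V^T, the singular values being the
   diagonal entries of the rectangular matrix S in nonincreasing order. *)
Record is_svd m n (A : 'M[R]_(m, n))
    (U : 'M[R]_m) (S : 'M[R]_(m, n)) (V : 'M[R]_n) : Prop := {
  svd_orthU : U^T *m U = 1%:M ;
  svd_orthV : V^T *m V = 1%:M ;
  svd_diag : is_diag_mx S ;
  svd_ge0 : forall (i : 'I_m) (j : 'I_n), i = j :> nat -> 0 <= S i j ;
  svd_mono : forall (i i' : 'I_m) (j j' : 'I_n),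
    i = j :> nat -> i' = j' :> nat -> (i <= i')%N -> S i' j' <= S i j ;
  svd_eq : A = U *m S *m V^T }.

(* j : 'I_(\rank A) is the mathematical index j + 1, 1 <= j + 1 <= rank(A). *)
Definition rank_row m n (A : 'M[R]_(m, n)) : 'I_(\rank A) -> 'I_m :=
  widen_ord (rank_leq_row A).
Definition rank_col m n (A : 'M[R]_(m, n)) : 'I_(\rank A) -> 'I_n :=
  widen_ord (rank_leq_col A).

Definition left_sv m n (A : 'M[R]_(m, n)) (U : 'M[R]_m) j : 'cV[R]_m :=
  col (@rank_row m n A j) U.
Definition right_sv m n (A : 'M[R]_(m, n)) (V : 'M[R]_n) j : 'cV[R]_n :=
  col (@rank_col m n A j) V.
Definition sing_val m n (A : 'M[R]_(m, n)) (S : 'M[R]_(m, n)) j : R :=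
  S (@rank_row m n A j) (@rank_col m n A j).

Definition rowv m n (A : 'M[R]_(m, n)) (i : 'I_m) : 'cV[R]_n := (row i A)^T.

(* For a zero row the quotient is 0 (as x / 0 = 0) and the step is the identity;
   such rows are selected with probability 0. *)
Definition kaczmarz_step m n (A : 'M[R]_(m, n)) (b : 'cV[R]_m)
    (i : 'I_m) (x : 'cV[R]_n) : 'cV[R]_n :=
  x - ((dot (rowv A i) x - b i 0) / norm2 (rowv A i) ^+ 2) *: rowv A i.

Fixpoint kaczmarz m n (A : 'M[R]_(m, n)) (b : 'cV[R]_m) (x0 : 'cV[R]_n)
    (s : nat -> 'I_m) (k : nat) : 'cV[R]_n :=
  if k is k'.+1 then kaczmarz_step A b (s k') (kaczmarz A b x0 s k') else x0.

End Euclidean.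

Section Sampling.
Context {d : measure_display} {T : measurableType d} {R : realType}.
Context (P : probability T R).

(* Mutual independence of a sequence of random variables with values in a
   finite type I, equipped with the sigma-algebra of all its subsets. *)
Definition mutually_independent (I : finType) (X : nat -> T -> I) : Prop :=
  forall (J : seq nat) (B : nat -> set I), uniq J ->
    P (\bigcap_(k in [set` J]) (X k @^-1` B k)) =
    (\prod_(k <- J) P (X k @^-1` B k))%E.

Record rk_sampling m n (A : 'M[R]_(m, n)) (idx : nat -> T -> 'I_m) : Prop := {
  rk_measurable : forall k (B : set 'I_m), measurable (idx k @^-1` B) ;
  rk_independent : mutually_independent idx ;
  rk_distribution : forall k (i : 'I_m),
    P (idx k @^-1` [set i]) = (norm2 (rowv A i) ^+ 2 / normF A ^+ 2)%:E }.

End Sampling.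

(* Main.v *)
Require Import Defs.
From HB Require Import structures.
From mathcomp Require Import all_boot all_order all_algebra.
From mathcomp Require Import all_classical all_reals all_analysis.
From mathcomp Require Import ring.

Set Implicit Arguments.
Unset Strict Implicit.
Unset Printing Implicit Defensive.

Import Order.TTheory GRing.Theory Num.Theory.
Local Open Scope classical_set_scope.
Local Open Scope ring_scope.

(** The iterates form a Markov chain driven by independent indices, so the
expectation of g(x_k) is Q^k g evaluated at x_0, where Q averages g over one
Kaczmarz step ([transition], [expectation_state]).  The weight of row i cancels
the normalisation of the step, and one step moves <x, v> on average by
  - <A x - b, A v> / |A|_F^2
for every vector v ([transition_kaczmarz_dot]).  When v = v_j is a right
singular vector, A v_j = sigma_j u_j and <A x, u_j> = sigma_j <x, v_j>, so this
drift depends on x through <x, v_j> alone: the affine function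
  h(x) = <x, v_j> - <b, u_j> / sigma_j
is an eigenfunction of Q, with eigenvalue rho = 1 - sigma_j^2 / |A|_F^2, and
E h(x_k) = rho^k h(x_0).

It remains to translate.  As v_j = A^T u_j / sigma_j lies in range(A^T), its
inner product ignores null-space components and sees x and its range component
alike.  Hence the quantity in the statement is h(x_k) plus the constant
<b, u_j> / sigma_j - <x_*, v_j> = - <A x_* - b, u_j> / sigma_j, and the formula
follows by collecting the terms with and without rho^k. *)

(** * Recursions driven by independent indices *)

Section RandomRecursion.
Context {d : measure_display} {T : measurableType d} {R : realType}.
Context (P : probability T R) {I : finType} {E : Type}.
Context (idx : nat -> T -> I) (p : I -> R) (step : I -> E -> E) (x0 : E).
Context (X : nat -> T -> E).
Context (idx_meas : forall k (B : set I), measurable (idx k @^-1` B)).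
Context (idx_indep : mutually_independent P idx).
Context (idx_law : forall k i, P (idx k @^-1` [set i]) = (p i)%:E).
Context (X0 : forall w, X 0 w = x0).
Context (XS : forall k w, X k.+1 w = step (idx k w) (X k w)).

Definition transition (g : E -> R) (x : E) : R := \sum_i p i * g (step i x).

(** Each application of [transition] is a finite weighted average, so it
commutes with the outer average over i; this exchanges the last draw with the
k draws before it. *)
Lemma iter_transition_sum k (h : I -> E -> R) x :
  iter k transition (fun y => \sum_i p i * h i y) x =
  \sum_i p i * iter k transition (h i) x.
Proof.
elim: k x => [|k IHk] x //=.
rewrite [LHS]/transition.
under [LHS]eq_bigr => i _ do rewrite IHk mulr_sumr.
rewrite exchange_big; apply: eq_bigr => i _.
by rewrite mulr_sumr; apply: eq_bigr => i' _; rewrite mulrCA.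
Qed.

(** No measurable structure is assumed on the state space: every preimage is
measurable because x_k is determined by finitely many draws from a finite
type. *)
Lemma measurable_preimage_state k (Y : set E) : measurable (X k @^-1` Y).
Proof.
elim: k Y => [|k IHk] Y.
  by rewrite (_ : X 0 = cst x0) ?preimage_cst; [case: ifP | apply/funext].
rewrite (_ : _ @^-1` _ = \bigcup_(i in [set: I])
    (idx k @^-1` [set i] `&` X k @^-1` (step i @^-1` Y))).
  by apply: fin_bigcup_measurable => // i _; apply: measurableI.
apply/seteqP; split => w /=; rewrite XS; first by exists (idx k w).
by case=> i _ [/= ->].
Qed.

(** The events to which mutual independence applies.  When every index in J is
at least k, such an event constrains only draws that x_k has not used. *)
Definition cylinder (J : seq nat) (B : nat -> set I) : set T :=
  \bigcap_(l in [set` J]) (idx l @^-1` B l).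

Lemma measurable_cylinder J B : measurable (cylinder J B).
Proof. by apply: fin_bigcap_measurable => // l _; apply: idx_meas. Qed.

Lemma cylinder_cons k i J B : k \notin J ->
  cylinder (k :: J) (fun l => if l == k then [set i] else B l) =
  idx k @^-1` [set i] `&` cylinder J B.
Proof.
move=> kJ; apply/seteqP; split => w /=.
  move=> wB; split; first by have := wB k (mem_head _ _); rewrite eqxx.
  move=> l lJ; have := wB l; rewrite /= inE lJ orbT => /(_ isT).
  by case: eqP lJ kJ => // -> ->.
case=> wk wB l /=; rewrite inE; case: eqP => [-> _|_] //=.
exact: wB.
Qed.

Lemma probability_cylinder_cons k i J B : uniq J -> k \notin J ->
  P (idx k @^-1` [set i] `&` cylinder J B) = ((p i)%:E * P (cylinder J B))%E.
Proof.
move=> uJ kJ; rewrite -cylinder_cons // /cylinder !idx_indep //=; last first.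
  by rewrite kJ.
rewrite big_cons eqxx idx_law; congr (_ * _)%E.
by apply: eq_big_seq => l lJ; case: eqP lJ kJ => // -> ->.
Qed.

(** Independence of x_k from the draws of index at least k, in integrated form.
Carrying a future event along makes the induction work without computing the
joint law of the first k draws: to pass from k + 1 to k, split the event
according to the value of draw k, which thereby becomes one more constraint on
draws of index at least k, while x_(k+1) becomes a function of x_k alone. *)
Lemma integral_state_cylinder k (g : E -> R) J B :
    uniq J -> {in J, forall l, (k <= l)%N} ->
  (\int[P]_(w in cylinder J B) (g (X k w))%:E =
   P (cylinder J B) * (iter k transition g x0)%:E)%E.
Proof.
elim: k g J B => [|k IHk] g J B uJ Jk.
  under eq_integral => w _ do rewrite X0.
  rewrite muleC; exact: integral_cst (measurable_cylinder J B) (g x0)%:E.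
have kJ : k \notin J by apply/negP => /Jk; rewrite ltnn.
(* The pieces on which draw k is constant. *)
pose F i := idx k @^-1` [set i] `&` cylinder J B.
have FE : cylinder J B = \big[setU/set0]_(i <- index_enum I) F i.
  rewrite -bigcup_seq; apply/seteqP; split => w /=.
    by move=> wB; exists (idx k w) => //=; exact: mem_index_enum.
  by case=> i _ [].
have mF i : measurable (F i).
  by apply: measurableI; [apply: idx_meas | apply: measurable_cylinder].
have tF : trivIset [set` index_enum I] F.
  by move=> i i' _ _ [w [[/= <- _] [/= <- _]]].
rewrite {1}FE integral_bigsetU_EFin //; last 2 first.
- exact: index_enum_uniq.
- move=> mD Y _; apply: measurableI => //.
  exact: (measurable_preimage_state k.+1 [set x | Y (g x)%:E]).
rewrite iterSr [transition g]/transition.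
rewrite (iter_transition_sum _ (fun i => g \o step i)).
rewrite -sumEFin fin_num_sume_distrr; last 2 first.
- exact: fin_num_measure (measurable_cylinder J B).
- by move=> i i' _ _; apply: fin_num_adde_defl.
apply: eq_bigr => i _.
transitivity (\int[P]_(w in F i) (((g \o step i) (X k w))%:E))%E.
  by apply: eq_integral => w; rewrite inE => -[/= wi _]; rewrite XS wi.
rewrite /F -cylinder_cons // IHk; last 2 first.
- by rewrite /= kJ.
- by move=> l; rewrite inE => /predU1P[->//|/Jk/ltnW].
rewrite cylinder_cons // probability_cylinder_cons // EFinM.
by rewrite [(_ * P _)%E]muleC muleA.
Qed.

Lemma expectation_state k (g : E -> R) :
  ('E_P[fun w => g (X k w)] = (iter k transition g x0)%:E)%E.
Proof.
have cylT : cylinder [::] (fun=> setT) = setT by apply/seteqP; split.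
rewrite unlock -cylT integral_state_cylinder //.
by rewrite cylT probability_setT mul1e.
Qed.

End RandomRecursion.

(** * Euclidean geometry and singular vectors *)

Section LinearAlgebra.
Context {R : realType}.

Lemma dotDl n (u v w : 'cV[R]_n) : dot (u + v) w = dot u w + dot v w.
Proof. by rewrite !dotE linearD mulmxDl mxE. Qed.

Lemma dotZl n a (u v : 'cV[R]_n) : dot (a *: u) v = a * dot u v.
Proof. by rewrite !dotE linearZ -scalemxAl mxE. Qed.

Lemma dotBl n (u v w : 'cV[R]_n) : dot (u - v) w = dot u w - dot v w.
Proof. by rewrite -scaleN1r dotDl dotZl mulN1r. Qed.

Lemma dotC n (u v : 'cV[R]_n) : dot u v = dot v u.
Proof. by apply: eq_bigr => i _; rewrite mulrC. Qed.

Lemma dot_mulmxl m n (A : 'M[R]_(m, n)) x y : dot (A *m x) y = dot x (A^T *m y).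
Proof. by rewrite !dotE trmx_mul mulmxA. Qed.

Lemma dot_rowv m n (A : 'M[R]_(m, n)) i x : dot (rowv A i) x = (A *m x) i 0.
Proof. by rewrite dotE trmxK -row_mul mxE. Qed.

Lemma sqr_norm2 n (v : 'cV[R]_n) : norm2 v ^+ 2 = dot v v.
Proof. by rewrite sqr_sqrtr // sumr_ge0 // => i _; rewrite -expr2 sqr_ge0. Qed.

Lemma sqr_normF m n (A : 'M[R]_(m, n)) :
  normF A ^+ 2 = \sum_i norm2 (rowv A i) ^+ 2.
Proof.
rewrite sqr_sqrtr => [|]; last by do 2!(apply: sumr_ge0 => ? _); apply: sqr_ge0.
apply: eq_bigr => i _; rewrite sqr_norm2.
by apply: eq_bigr => k _; rewrite !mxE expr2.
Qed.

Lemma normF_eq0 m n (A : 'M[R]_(m, n)) : (normF A == 0) = (A == 0).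
Proof.
apply/eqP/eqP => [F0|->]; last first.
  rewrite /normF big1 ?sqrtr0 // => i _.
  by rewrite big1 // => k _; rewrite mxE expr0n.
have rows0 : \sum_i norm2 (rowv A i) ^+ 2 = 0.
  by rewrite -sqr_normF F0 expr0n.
apply/row_matrixP => i; apply: trmx_inj; rewrite row0 trmx0.
by apply: dot_eq0; rewrite -sqr_norm2 (psumr_eq0P _ rows0) // => *; apply: sqr_ge0.
Qed.

Lemma dot_range_part m n (A : 'M[R]_(m, n)) x v :
  (v^T <= A)%MS -> dot (range_part A x) v = dot x v.
Proof.
move=> vA; have [_ /(_ v vA)] := orthprojP A x.
by rewrite dotC dotBl => /eqP; rewrite subr_eq0 => /eqP.
Qed.

Lemma dot_null_part m n (A : 'M[R]_(m, n)) x v :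
  (v^T <= A)%MS -> dot (null_part A x) v = 0.
Proof.
move=> /submxP[D vE]; have [/sub_kermxP xA0 _] := orthprojP (kermx A^T) x.
by rewrite -[v]trmxK vE trmx_mul dotE mulmxA xA0 mul0mx mxE.
Qed.

Lemma svd_mul_right m n (A : 'M[R]_(m, n)) U S V (j : 'I_(\rank A)) :
  is_svd A U S V -> A *m right_sv V j = sing_val S j *: left_sv U j.
Proof.
case=> _ oV /is_diag_mxP dS _ _ AE.
rewrite {1}AE /right_sv colE -!mulmxA (mulmxA V^T) oV mul1mx /left_sv colE.
rewrite scalemxAr; congr (_ *m _); apply/colP => i; rewrite -colE !mxE.
rewrite andbT; have [->|ij] := eqVneq i (rank_row j); first by rewrite mulr1.
by rewrite mulr0 dS.
Qed.

Lemma svd_tr_mul_left m n (A : 'M[R]_(m, n)) U S V (j : 'I_(\rank A)) :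
  is_svd A U S V -> A^T *m left_sv U j = sing_val S j *: right_sv V j.
Proof.
case=> oU _ /is_diag_mxP dS _ _ AE.
rewrite {1}AE !trmx_mul trmxK /left_sv colE -!mulmxA (mulmxA U^T) oU mul1mx.
rewrite /right_sv colE scalemxAr; congr (_ *m _).
apply/colP => i; rewrite -colE !mxE.
rewrite andbT; have [->|ij] := eqVneq i (rank_col j); first by rewrite mulr1.
by rewrite mulr0 dS // eq_sym.
Qed.

(** If the j-th diagonal entry of S vanished, monotonicity would kill all the
later ones, so S would have at most j nonzero rows and A rank at most j. *)
Lemma sing_val_gt0 m n (A : 'M[R]_(m, n)) U S V (j : 'I_(\rank A)) :
  is_svd A U S V -> 0 < sing_val S j.
Proof.
case=> _ _ /is_diag_mxP dS S0 Sm AE.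
rewrite lt_neqAle S0 // andbT eq_sym; apply/eqP => sj0.
have jm : (j <= m)%N by apply: ltnW; apply: ltn_ord (rank_row j).
(* [pid_mx j] keeps the rows of index below j and clears the others, so this
   bounds the rank of S by j. *)
suff SE : S = pid_mx j *m S.
  have : (\rank (U *m S *m V^T) <= j)%N.
    apply: leq_trans (mxrankM_maxl _ _) _.
    apply: leq_trans (mxrankM_maxr _ _) _.
    by rewrite SE -[X in (_ <= X)%N](rank_pid_mx R jm jm) mxrankM_maxl.
  by rewrite -AE leqNgt ltn_ord.
apply/matrixP => i k; rewrite !mxE (bigD1 i) //= big1 => [|i' ii']; last first.
  by rewrite mxE -[_ == _ :> nat]/(i == i') eq_sym (negPf ii') mul0r.
rewrite mxE eqxx addr0 /=; have [ij|ji] := ltnP i j; first by rewrite mul1r.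
rewrite mul0r; have [ik|/dS//] := eqVneq (i : nat) k.
by apply/le_anti; rewrite S0 // andbT -sj0 Sm.
Qed.

(** v_j = A^T (u_j / sigma_j); this is where sigma_j > 0 matters. *)
Lemma right_sv_sub m n (A : 'M[R]_(m, n)) U S V (j : 'I_(\rank A)) :
  is_svd A U S V -> ((right_sv V j)^T <= A)%MS.
Proof.
move=> svdA; have s0 := sing_val_gt0 j svdA.
apply/submxP; exists ((sing_val S j)^-1 *: (left_sv U j)^T).
apply: trmx_inj; rewrite trmxK -scalemxAl linearZ /= trmx_mul trmxK.
by rewrite (svd_tr_mul_left j svdA) scalerA mulVf ?scale1r ?gt_eqF.
Qed.

End LinearAlgebra.

(** * One Kaczmarz step in expectation *)

Section KaczmarzTransition.
Context {R : realType} {m n : nat} (A : 'M[R]_(m, n)) (b : 'cV[R]_m).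
Context (A_neq0 : A != 0).

Definition row_weight (i : 'I_m) : R := norm2 (rowv A i) ^+ 2 / normF A ^+ 2.

Lemma sum_row_weight : \sum_i row_weight i = 1.
Proof.
by rewrite -mulr_suml -sqr_normF divff // sqrf_eq0 normF_eq0.
Qed.

(** The weight |a_i|^2 / |A|_F^2 cancels the division by |a_i|^2 in the step.  For
a zero row both corrections vanish, the one on the right because (A v)_i = 0. *)
Lemma row_weight_mul_step i x v :
  row_weight i * dot (kaczmarz_step A b i x) v =
  row_weight i * dot x v - (A *m x - b) i 0 * (A *m v) i 0 / normF A ^+ 2.
Proof.
rewrite /kaczmarz_step dotBl dotZl mulrBr; congr (_ - _).
rewrite -!(dot_rowv A i v) dot_rowv [(_ - b) i 0]mxE [(- b) i 0]mxE.
rewrite /row_weight; have [a0|a0] := eqVneq (rowv A i) 0.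
  by rewrite a0 -(scale0r (0 : 'cV[R]_n)) dotZl !(mul0r, mulr0).
have {}a0 : norm2 (rowv A i) != 0.
  apply: contra_neq a0 => a0; apply: dot_eq0.
  by rewrite -sqr_norm2 a0 expr0n.
field.
by rewrite normF_eq0 A_neq0 a0.
Qed.

Lemma transition_kaczmarz_dot x v :
  \sum_i row_weight i * dot (kaczmarz_step A b i x) v =
  dot x v - dot (A *m x - b) (A *m v) / normF A ^+ 2.
Proof.
under eq_bigr => i _ do rewrite row_weight_mul_step.
by rewrite sumrB -mulr_suml sum_row_weight mul1r -mulr_suml.
Qed.

(** h is an eigenfunction of the averaging operator because
<A x - b, A v_j> = sigma_j <A x - b, u_j> = sigma_j^2 h(x); constants are fixed
because the weights sum to 1. *)
Lemma iter_transition_kaczmarz U S V (j : 'I_(\rank A)) c k x :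
  is_svd A U S V ->
  let sigma := sing_val S j in
  let h y := dot y (right_sv V j) - dot b (left_sv U j) / sigma in
  iter k (transition row_weight (kaczmarz_step A b)) (fun y => h y + c) x =
  (1 - sigma ^+ 2 / normF A ^+ 2) ^+ k * h x + c.
Proof.
move=> svdA sigma h; set rho := 1 - _.
elim: k x => [|k IHk] x; first by rewrite expr0 mul1r.
rewrite iterS /transition.
under eq_bigr => i _ do rewrite IHk.
have s0 : sigma != 0 by rewrite gt_eqF // (sing_val_gt0 j svdA).
have F0 : normF A != 0 by rewrite normF_eq0.
(* Affine in <x, v_j>: both averages that remain are known in closed form. *)
transitivity (rho ^+ k * (\sum_i row_weight i *
    dot (kaczmarz_step A b i x) (right_sv V j)) +
  (c - rho ^+ k * (dot b (left_sv U j) / sigma)) * \sum_i row_weight i).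
  rewrite !mulr_sumr -big_split; apply: eq_bigr => i _ /=; rewrite /h; ring.
rewrite transition_kaczmarz_dot sum_row_weight (svd_mul_right j svdA) -/sigma.
rewrite [dot _ (sigma *: _)]dotC dotZl [dot (left_sv U j) _]dotC dotBl.
rewrite dot_mulmxl (svd_tr_mul_left j svdA) [dot x (_ *: _)]dotC dotZl -/sigma.
rewrite [dot (right_sv V j) x]dotC [rho ^+ k.+1]exprS /h.
move: (rho ^+ k) => r; rewrite /rho; field.
by rewrite s0 F0.
Qed.

End KaczmarzTransition.

(** * The mean error along a singular direction *)

Theorem theorem7 (R : realType) (d : measure_display) (T : measurableType d)
  (P : probability T R) (m n : nat)
  (A : 'M[R]_(m, n)) (hA : A != 0) (b : 'cV[R]_m) (x0 : 'cV[R]_n)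
  (idx : nat -> T -> 'I_m) (hidx : rk_sampling P A idx)
  (U : 'M[R]_m) (S : 'M[R]_(m, n)) (V : 'M[R]_n) (hsvd : is_svd A U S V)
  (xs : 'cV[R]_n) (j : 'I_(\rank A)) (k : nat) :
  let sigma := sing_val S j in
  let u := left_sv U j in
  let v := right_sv V j in
  let rho := 1 - sigma ^+ 2 / normF A ^+ 2 in
  ('E_P[fun w : T =>
     dot (kaczmarz A b x0 (fun l => idx l w) k
            - null_part A x0 - range_part A xs) v]
   = (rho ^+ k * dot (range_part A x0 - range_part A xs) v
      - (1 - rho ^+ k) * (dot (A *m xs - b) u / sigma))%:E)%E.
Proof.
move=> sigma u v rho.
have vA : (v^T <= A)%MS := right_sv_sub j hsvd.
have s0 : sigma != 0 by rewrite gt_eqF // (sing_val_gt0 j hsvd).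
have [idx_meas idx_indep idx_law] := hidx.
(* t is the value of <x, v> at which the mean drift along v vanishes. *)
pose t := dot b u / sigma.
pose g y := dot y v - t + (t - dot xs v).
transitivity ('E_P[fun w => g (kaczmarz A b x0 (idx ^~ w) k)])%E.
  congr ('E_P[_])%E; apply/funext => w.
  rewrite !dotBl dot_null_part // dot_range_part // /g; ring.
rewrite (expectation_state (p := row_weight A) (step := kaczmarz_step A b)
  (X := fun k w => kaczmarz A b x0 (idx ^~ w) k) idx_meas idx_indep idx_law
  (fun=> erefl) (fun _ _ => erefl)).
rewrite iter_transition_kaczmarz // -/sigma -/u -/v -/rho -/t.
congr (_%:E); rewrite !dotBl !dot_range_part // dot_mulmxl.
rewrite (svd_tr_mul_left j hsvd) [dot xs (_ *: _)]dotC dotZl -/sigma -/v.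
rewrite [dot v xs]dotC /t; field.
exact: s0.
Qed.
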